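(* Let $\Omega\subset\mathbb{R}^d$ be bounded, nonempty and open and let $\gamma:\mathbb{R}^d\times\mathbb{R}^d\to[0,\infty)$ be measurable. Assume that $\int_\Gamma\gamma(z,x)\,dz<\infty$ for a.e. $x\in\Omega$. Let $c\in[0,\infty)$ satisfy $\big(\operatorname*{ess\,inf}_{x\in\Omega}\int_\Gamma\gamma(y,x)\,dy\big)+c>0$ and define $w:\Gamma\to(0,\infty]$ by $$w(y)=\int_\Omega\frac{\gamma(y,x)}{\int_\Gamma\gamma(z,x)\,dz+c}\,dx.$$ Then $\{y\in\Gamma: w(y)=\infty\}$ is a null set and $$\operatorname{Tr}:\mathrm{V}(\Omega;\gamma)\to L^2(\Gamma;w),\quad \operatorname{Tr}(v)=v|_\Gamma,$$ is a continuous linear operator.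
   Context: Measurability is with respect to Lebesgue measure. Let $\Gamma:=\{y\in\mathbb{R}^d\setminus\Omega:\int_\Omega\gamma(y,x)\,dx>0\}$. $\mathrm{V}(\Omega;\gamma)$ is the space of measurable $v:\mathbb{R}^d\to\mathbb{R}$ with $$\|v\|_{\mathrm{V}(\Omega;\gamma)}^2:=\int_\Omega v^2(x)\,dx+\int_\Omega\int_{\mathbb{R}^d}(v(x)-v(y))^2\gamma(y,x)\,dy\,dx<\infty,$$ functions agreeing a.e. on $\Omega\cup\Gamma$ being identified. $L^2(\Gamma;w)$ is the weighted Lebesgue space with norm $\|v\|_{L^2(\Gamma;w)}^2=\int_\Gamma v^2(y)w(y)\,dy$. *)

(* Defs.v *)
From HB Require Import structures.
From mathcomp Require Import all_boot all_order all_algebra.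
From mathcomp Require Import all_classical all_reals all_analysis.
From mathcomp Require Import ess_sup_inf.

Set Implicit Arguments.
Unset Strict Implicit.
Unset Printing Implicit Defensive.

Import Order.TTheory GRing.Theory Num.Theory.
Import numFieldNormedType.Exports.

Local Open Scope classical_set_scope.
Local Open Scope ring_scope.

(* The Borel sigma-algebra of R^d, generated by the coordinate functions (as
   the library does for [d.-tuple R]). *)
Fact rV_display : measure_display.
Proof. exact: default_measure_display. Qed.

Section rV_measurable.
Context {R : realType} (d : nat).

Definition rV_coord (i : 'I_d) (x : 'rV[R]_d) : measurableTypeR R := x ord0 i.

Let rV_set0 : g_sigma_preimage rV_coord set0.
Proof. exact: sigma_algebra0. Qed.

Let rV_setC A : g_sigma_preimage rV_coord A ->
  g_sigma_preimage rV_coord (~` A).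
Proof. exact: sigma_algebraC. Qed.

Let rV_bigcup (F : _^nat) : (forall i, g_sigma_preimage rV_coord (F i)) ->
  g_sigma_preimage rV_coord (\bigcup_i (F i)).
Proof. exact: sigma_algebra_bigcup. Qed.

HB.instance Definition _ := @isMeasurable.Build rV_display 'rV[R]_d
  (g_sigma_preimage rV_coord) rV_set0 rV_setC rV_bigcup.

End rV_measurable.

Section rV_measurable_fun.
Context {R : realType}.

Lemma measurable_rV_coord d (i : 'I_d) :
  measurable_fun [set: 'rV[R]_d] (rV_coord i).
Proof.
move=> _ Y mY; rewrite setTI; apply: sub_sigma_algebra => /=.
rewrite -bigcup_seq/=; exists i => /=; first by rewrite mem_index_enum.
by exists Y => //; rewrite setTI.
Qed.

Lemma measurable_fun_rVP d0 (T : measurableType d0) d (f : T -> 'rV[R]_d) :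
  (forall i, measurable_fun [set: T] (rV_coord i \o f)) ->
  measurable_fun [set: T] f.
Proof.
move=> mf; suff prefS :
    g_sigma_preimage (fun i => @rV_coord R d i \o f) `<=` measurable.
  move=> _ A mA; apply: prefS.
  by rewrite g_sigma_preimage_comp; exists A.
apply: smallest_sub; first exact: sigma_algebra_measurable.
case: d => [|d] in f mf *; first by rewrite big_ord0.
rewrite -bigcup_mkord_ord; apply: bigcup_sub => i Ii.
by move=> A [B mB <-]; exact: mf.
Qed.

Definition rV_cons d (p : measurableTypeR R * 'rV[R]_d) : 'rV[R]_d.+1 :=
  row_mx (p.1 : R)%:M p.2 : 'rV[R]_(1 + d).

Definition rV_behead d (x : 'rV[R]_d.+1) : 'rV[R]_d :=
  \row_i x ord0 (lift ord0 i).

Lemma rV_cons0 d (p : measurableTypeR R * 'rV[R]_d) : rV_coord ord0 (rV_cons p) = p.1.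
Proof.
have <- : row_mx (p.1 : R)%:M p.2 ord0 (lshift d (ord0 : 'I_1)) = p.1.
  by rewrite row_mxEl mxE eqxx mulr1n.
by congr (_ _ _); exact/val_inj.
Qed.

Lemma rV_consS d (p : measurableTypeR R * 'rV[R]_d) i :
  rV_coord (lift ord0 i) (rV_cons p) = rV_coord i p.2.
Proof.
have <- : row_mx (p.1 : R)%:M p.2 ord0 (rshift 1 i) = rV_coord i p.2.
  by rewrite row_mxEr.
by congr (_ _ _); exact/val_inj.
Qed.

Lemma rV_consK d (p : measurableTypeR R * 'rV[R]_d) : rV_behead (rV_cons p) = p.2.
Proof. by apply/rowP => i; rewrite mxE; exact: rV_consS. Qed.

Lemma measurable_rV_cons d : measurable_fun [set: measurableTypeR R * 'rV[R]_d] (@rV_cons d).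
Proof.
apply: measurable_fun_rVP => i; have [->|[j ->]] : i = ord0 \/ exists j, i = lift ord0 j.
- by case: (unliftP ord0 i) => [j|] ->; [right; exists j|left].
- rewrite (_ : _ \o _ = fst); first exact: measurable_fst.
  by apply/funext => p; exact: rV_cons0.
- rewrite (_ : _ \o _ = rV_coord j \o snd).
    by apply: measurableT_comp; [exact: measurable_rV_coord|exact: measurable_snd].
  by apply/funext => p; exact: rV_consS.
Qed.

Lemma measurable_rV_behead d : measurable_fun [set: 'rV[R]_d.+1] (@rV_behead d).
Proof.
apply: measurable_fun_rVP => i.
rewrite (_ : _ \o _ = rV_coord (lift ord0 i)); first exact: measurable_rV_coord.
by apply/funext => x; rewrite /rV_coord /= mxE.
Qed.

End rV_measurable_fun.

(* Lebesgue measure on the Borel sets of R^d, as the d-fold product of the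
   one-dimensional one. *)
Section borel_lebesgue.
Local Open Scope ereal_scope.
Context {R : realType}.

Section step.
Context d (m : {sigma_finite_measure set 'rV[R]_d -> \bar R}).

Definition borel_lebesgueS : set 'rV[R]_d.+1 -> \bar R :=
  pushforward (@lebesgue_measure R \x m) (@rV_cons R d).

Let preimage_rV_cons (A : set 'rV[R]_d.+1) : measurable A ->
  measurable (@rV_cons R d @^-1` A).
Proof. by move=> mA; rewrite -[X in measurable X]setTI; exact: measurable_rV_cons. Qed.

Let borel_lebesgueS0 : borel_lebesgueS set0 = 0.
Proof. by rewrite /borel_lebesgueS /pushforward preimage_set0 measure0. Qed.

Let borel_lebesgueS_ge0 A : 0 <= borel_lebesgueS A.
Proof. by rewrite /borel_lebesgueS /pushforward; exact: measure_ge0. Qed.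

Let borel_lebesgueS_sigma_additive : semi_sigma_additive borel_lebesgueS.
Proof.
move=> F mF tF mUF; rewrite /borel_lebesgueS /pushforward preimage_bigcup.
apply: measure_semi_sigma_additive.
- by move=> n; exact: preimage_rV_cons.
- apply/trivIsetP => /= i j _ _ ij; rewrite -preimage_setI.
  by move/trivIsetP : tF => /(_ _ _ _ _ ij) ->//; rewrite preimage_set0.
- by rewrite -preimage_bigcup; exact: preimage_rV_cons.
Qed.

HB.instance Definition _ := isMeasure.Build _ _ _ borel_lebesgueS
  borel_lebesgueS0 borel_lebesgueS_ge0 borel_lebesgueS_sigma_additive.

Let sigma_finiteS : sigma_finite setT borel_lebesgueS.
Proof.
have [F FT mF] : sigma_finite setT (@lebesgue_measure R \x m).
  have /sigma_finiteP[F [TF ndF Foo]] := sigma_finiteT (@lebesgue_measure R).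
  have /sigma_finiteP[G [TG ndG Goo]] := sigma_finiteT m.
  exists (fun n => F n `*` G n).
    rewrite -setXTT TF TG predeqE => -[x y]; split.
      move=> [/= [n _ Fnx] [k _ Gky]]; exists (maxn n k) => //; split.
      - by move: x Fnx; exact/subsetPset/ndF/leq_maxl.
      - by move: y Gky; exact/subsetPset/ndG/leq_maxr.
    by move=> [n _ []/= ? ?]; split; exists n.
  move=> k; have [? ?] := Foo k; have [? ?] := Goo k.
  split; first exact: measurableX.
  by rewrite product_measure1E// lte_mul_pinfty// ge0_fin_numE.
pose uncons (x : 'rV[R]_d.+1) := (rV_coord ord0 x, rV_behead x).
have muncons : measurable_fun setT uncons.
  apply/measurable_fun_pairP; split.
    exact: measurable_rV_coord.
  exact: measurable_rV_behead.
have consK p : uncons (rV_cons p) = p.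
  by case: p => a x; rewrite /uncons rV_cons0 rV_consK.
exists (fun k => uncons @^-1` F k).
  by rewrite -preimage_bigcup -FT preimage_setT.
move=> k; have [mFk Fkoo] := mF k; split.
  by rewrite -[X in measurable X]setTI; exact: muncons.
rewrite /borel_lebesgueS /pushforward -comp_preimage.
by rewrite (_ : uncons \o _ = id)// funeqE.
Qed.

HB.instance Definition _ :=
  @Measure_isSigmaFinite.Build _ _ _ borel_lebesgueS sigma_finiteS.

End step.

Fixpoint borel_lebesgue d : {sigma_finite_measure set 'rV[R]_d -> \bar R} :=
  match d with
  | 0 => \d_(0%R : 'rV[R]_0)
  | d'.+1 => borel_lebesgueS (borel_lebesgue d')
  end.

End borel_lebesgue.

Section lebesgue.
Local Open Scope ereal_scope.
Context {R : realType}.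

Lemma measurable_rV_box d (a b : 'I_d -> R) :
  measurable [set x : 'rV[R]_d | forall i, x ord0 i \in `]a i, b i]].
Proof.
rewrite (_ : mkset _ = \bigcap_(i in [set: 'I_d])
  (@rV_coord R d i @^-1` [set` `]a i, b i]])); last first.
  by apply/seteqP; split => x /= h i; [move=> _; exact: h|exact: (h i I)].
apply: fin_bigcap_measurable => // i _.
by rewrite -[X in measurable X]setTI; exact: measurable_rV_coord.
Qed.

Lemma borel_lebesgue_box d (a b : 'I_d -> R) : (forall i, a i <= b i)%R ->
  borel_lebesgue d [set x : 'rV[R]_d | forall i, x ord0 i \in `]a i, b i]] =
  (\prod_(i < d) (b i - a i))%:E.
Proof.
elim: d a b => [|d ih] a b ab.
  by rewrite big_ord0 /= diracE mem_set// => -[].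
rewrite big_ord_recl EFinM -(ih (a \o lift ord0) (b \o lift ord0)); last first.
  by move=> i; exact: ab.
rewrite /= /borel_lebesgueS /pushforward.
have := measurable_rV_box (a \o lift ord0) (b \o lift ord0).
set B := (X in measurable X) => mB.
have m0 : measurable ([set` `]a ord0, b ord0]] : set (measurableTypeR R)).
  by apply: sub_sigma_algebra; exact: is_ocitv.
rewrite (_ : _ @^-1` _ = [set` `]a ord0, b ord0]] `*` B); last first.
  apply/seteqP; split => [p /= h|p /= [h1 h2] i].
    split=> [|i]; first by have := h ord0; rewrite [X in X \in _](rV_cons0 p).
    by have := h (lift ord0 i); rewrite [X in X \in _](rV_consS p).
  case: (unliftP ord0 i) => [j|] ->.
    by rewrite [X in X \in _](rV_consS p); exact: h2.
  by rewrite [X in X \in _](rV_cons0 p).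
rewrite product_measure1E//; congr (_ * _).
rewrite [LHS](lebesgue_measure_itv `]a ord0, b ord0]%R)/= lte_fin.
have := ab ord0; rewrite le_eqVlt => /predU1P[->|->//].
by rewrite ltxx subrr.
Qed.

(* R^d with its Lebesgue sigma-algebra, and Lebesgue measure: the completion
   (Caratheodory extension) of the Borel measure above. *)
Definition lebesgue_type d : Type :=
  @caratheodory_type R 'rV[R]_d ((@borel_lebesgue R d)^*)%mu.
HB.instance Definition _ d := Measurable.on (lebesgue_type d).

Definition lebesgue_rV d : set (lebesgue_type d) -> \bar R :=
  @completed_measure_extension _ 'rV[R]_d R (@borel_lebesgue R d).
HB.instance Definition _ d := Measure.on (@lebesgue_rV d).

(* The Lebesgue sigma-algebra of R^d x R^d = R^(2d), i.e. the completion of the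
   product; it is in general larger than the product of the two Lebesgue
   sigma-algebras. *)
Definition lebesgue_type2 d : Type :=
  @caratheodory_type R ('rV[R]_d * 'rV[R]_d)
    ((@borel_lebesgue R d \x @borel_lebesgue R d)^*)%mu.
HB.instance Definition _ d := Measurable.on (lebesgue_type2 d).

Definition lebesgue_measurable_fun d (D : set 'rV[R]_d) (v : 'rV[R]_d -> R) :=
  measurable_fun (D : set (lebesgue_type d)) (v : lebesgue_type d -> R).

Definition lebesgue_measurable_fun2 d (g : 'rV[R]_d * 'rV[R]_d -> R) :=
  measurable_fun [set: lebesgue_type2 d] (g : lebesgue_type2 d -> R).

Definition ess_inf_on d (D : set 'rV[R]_d) (f : 'rV[R]_d -> \bar R) : \bar R :=
  ess_inf (@lebesgue_rV d) (patch (cst +oo) D f : lebesgue_type d -> \bar R).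

End lebesgue.
Arguments lebesgue_rV {R} d.

(* A space of (classes of) real functions, given through representatives:
   the admissible functions, the identification between them, and the norm. *)
Record fun_space (R : realType) (T : Type) := FunSpace {
  fs_carrier : set (T -> R);
  fs_eq : (T -> R) -> (T -> R) -> Prop;
  fs_norm : (T -> R) -> \bar R }.

Definition fs_subspace (R : realType) (T : Type) (X : fun_space R T) :=
  fs_carrier X (cst 0) /\
  forall a u v, fs_carrier X u -> fs_carrier X v ->
    fs_carrier X (fun x => a * u x + v x).

(* [F] acts on representatives; linearity is meant between linear spaces, and
   modulo the identification of the target. *)
Definition continuous_linear_operator (R : realType) (T : Type)
    (X Y : fun_space R T) (F : (T -> R) -> (T -> R)) :=
  [/\ fs_subspace X /\ fs_subspace Y,
      forall u, fs_carrier X u -> fs_carrier Y (F u),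
      forall u v, fs_carrier X u -> fs_carrier X v ->
        fs_eq X u v -> fs_eq Y (F u) (F v),
      forall a u v, fs_carrier X u -> fs_carrier X v ->
        fs_eq Y (F (fun x => a * u x + v x)) (fun x => a * F u x + F v x) &
      forall u, fs_carrier X u -> forall e : R, 0 < e ->
        exists2 r : R, 0 < r & forall v, fs_carrier X v ->
          (fs_norm X (fun x => v x - u x)%R < r%:E)%E ->
          (fs_norm Y (fun x => F v x - F u x)%R < e%:E)%E].

Section nonlocal_spaces.
Local Open Scope ereal_scope.
Context {R : realType} (d : nat).
Local Notation lambda := (@lebesgue_rV R d).
Implicit Types (D Omega : set 'rV[R]_d) (gamma : 'rV[R]_d * 'rV[R]_d -> R).
Implicit Types (v : 'rV[R]_d -> R) (w : 'rV[R]_d -> \bar R).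

(* The section [gamma (y, _)] is Lebesgue measurable only for almost every y;
   for the other y the library's integral is the supremum over the nonnegative
   simple functions below the integrand, which only affects a null set. *)
Definition nonlocal_boundary Omega gamma : set 'rV[R]_d :=
  [set y | ~ Omega y /\ 0 < \int[lambda]_(x in Omega) (gamma (y, x))%:E].

Definition V_norm_sq Omega gamma v : \bar R :=
  \int[lambda]_(x in Omega) (v x ^+ 2)%:E +
  \int[lambda]_(x in Omega) \int[lambda]_y
    ((v x - v y) ^+ 2 * gamma (y, x))%:E.

Definition V_space Omega gamma : fun_space R 'rV[R]_d := {|
  fs_carrier := [set v | lebesgue_measurable_fun setT v /\
                         V_norm_sq Omega gamma v < +oo];
  fs_eq u v := {ae lambda, forall x,
    (Omega `|` nonlocal_boundary Omega gamma) x -> u x = v x};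
  fs_norm v := sqrte (V_norm_sq Omega gamma v) |}.

Definition L2_norm_sq D w v : \bar R :=
  \int[lambda]_(y in D) ((v y ^+ 2)%:E * w y).

(* Functions on D are represented by functions on R^d whose values outside D
   are irrelevant. *)
Definition L2_space D w : fun_space R 'rV[R]_d := {|
  fs_carrier := [set v | lebesgue_measurable_fun D v /\ L2_norm_sq D w v < +oo];
  fs_eq u v := {ae lambda, forall y, D y -> u y = v y};
  fs_norm v := sqrte (L2_norm_sq D w v) |}.

Definition trace_weight Omega gamma (c : R) (y : 'rV[R]_d) : \bar R :=
  \int[lambda]_(x in Omega) ((gamma (y, x))%:E /
    (\int[lambda]_(z in nonlocal_boundary Omega gamma) (gamma (z, x))%:E
     + c%:E)).

Definition trace Omega gamma v : 'rV[R]_d -> R :=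
  v \_ (nonlocal_boundary Omega gamma).

End nonlocal_spaces.

(* Main.v *)
(** Write [G x] for the mass of [gamma (_, x)] over the nonlocal boundary, so
    that [w y] is the integral of [gamma (y, x) / (G x + c)] over [Omega].  Since
    [v y ^+ 2 <= 2 (v x - v y) ^+ 2 + 2 v x ^+ 2], Tonelli's theorem bounds the
    weighted norm of the trace by [2 / delta] times the nonlocal energy, [delta]
    being an essential lower bound of [G + c], plus twice the integral of
    [v x ^+ 2 * (G x / (G x + c))], where the quotient is at most [1].  The
    constant [v = 1] has finite energy because [Omega] is bounded, so [w] is
    integrable, hence finite almost everywhere.

    As [gamma] is only measurable for the completion of the product measure, it
    is first replaced by a kernel, measurable for the product sigma-algebra, with
    the same sections almost everywhere.  Positivity of [w] is claimed at every
    point of the boundary, including those where the section of [gamma] is not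
    measurable: there the integral is a supremum over simple functions, and one
    argues with a simple function below the section. *)

From HB Require Import structures.
Require Import Defs.
From mathcomp Require Import all_boot all_order all_algebra.
From mathcomp Require Import all_classical all_reals all_analysis.
From mathcomp Require Import ess_sup_inf measurable_realfun ring lra.

Import Order.TTheory GRing.Theory Num.Theory.
Import numFieldNormedType.Exports.

Local Open Scope classical_set_scope.
Local Open Scope ring_scope.
Local Open Scope ereal_scope.

Set Implicit Arguments.
Unset Strict Implicit.

(** * Completion of a Borel measure *)

Section borel_hull.
Context d (T : measurableType d) (R : realType).
Variable mu : {measure set T -> \bar R}.

(** The outer measure is an infimum over countable measurable covers. Intersecting covers whose
    excess is at most [1 / (n + 1)] loses nothing in the limit. *)
Lemma measurable_hull (X : set T) : exists2 E : set T,
  measurable E /\ X `<=` E & mu E <= (mu^*)%mu X.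
Proof.
have [Xoo|Xoo] := eqVneq ((mu^*)%mu X) +oo.
  by exists setT; [split|rewrite Xoo leey].
have Xfin : (mu^*)%mu X \is a fin_num.
  by rewrite ge0_fin_numE ?ltey//; exact: mu_ext_ge0.
have /choice[F FP] (n : nat) : exists E : set T,
    [/\ measurable E, X `<=` E & mu E <= (mu^*)%mu X + (n.+1%:R^-1)%:E].
  have n0 : (0 < n.+1%:R^-1 :> R)%R by rewrite invr_gt0.
  have [_ [A [mA XA] <-] Ale] := lb_ereal_inf_adherent n0 Xfin.
  exists (\bigcup_k A k); split => //; first exact: bigcupT_measurable.
  apply: le_trans (ltW Ale).
  by apply: measure_sigma_subadditive => //; exact: bigcupT_measurable.
have mF : measurable (\bigcap_n F n).
  by apply: bigcapT_measurable => n; have [] := FP n.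
exists (\bigcap_n F n).
  by split => // x Xx n _; have [_ XF _] := FP n; exact: XF.
apply/lee_addgt0Pr => e e0.
have [N _ /(_ N (leqnn _)) Ne] := near_infty_natSinv_lt (PosNum e0).
have [mFN _ FN] := FP N.
apply: (@le_trans _ _ (mu (F N))).
  by apply: le_measure; rewrite ?inE//; exact: bigcap_inf.
by apply: le_trans FN _; rewrite leeD2l// lee_fin ltW.
Qed.

(* A Caratheodory set of finite outer measure differs from its measurable hull
   by an outer-null set, which has itself a null measurable hull. *)
Let cara_borel_fin (A : set T) : (mu^*)%mu.-cara.-measurable A ->
  (mu^*)%mu A < +oo ->
  exists E N : set T, [/\ measurable E, measurable N, mu N = 0, A `<=` E &
    E `\` A `<=` N].
Proof.
move=> mA Aoo; have [E [mE AE] EA] := measurable_hull A.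
have [N [mN EN] N0] := measurable_hull (E `\` A).
exists E, N; split => //; apply/eqP; rewrite eq_le measure_ge0 andbT.
apply: (le_trans N0); have := mA E.
rewrite /= measurable_mu_extE// (setIidr AE) -setDE => EE.
have Afin : (mu^*)%mu A \is a fin_num.
  by rewrite ge0_fin_numE//; exact: mu_ext_ge0.
by move: EA; rewrite EE -[leRHS]adde0 leeD2lE.
Qed.

Hypothesis sf : sigma_finite setT mu.

(** Sigma-finiteness cuts [A] into countably many pieces of finite outer measure, and the finite
    case applies to each piece. *)
Lemma caratheodory_borel (A : set T) : (mu^*)%mu.-cara.-measurable A ->
  exists E N : set T, [/\ measurable E, measurable N, mu N = 0, A `<=` E &
    E `\` A `<=` N].
Proof.
move=> mA; have [F FT /all_and2[mF Foo]] := sf.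
have /choice[E /choice[N P]] k : exists E N : set T,
    [/\ measurable E, measurable N, mu N = 0, A `&` F k `<=` E &
    E `\` (A `&` F k) `<=` N].
  apply: cara_borel_fin.
    exact/caratheodory_measurable_setI/caratheodory_measurable_mu_ext.
  apply: le_lt_trans (Foo k); rewrite -[leRHS](measurable_mu_extE mu (mF k)).
  exact: le_mu_ext.
exists (\bigcup_k (E k `&` F k)), (\bigcup_k N k); split.
- by apply: bigcupT_measurable => k; apply: measurableI => //; have [] := P k.
- by apply: bigcupT_measurable => k; have [] := P k.
- apply/negligibleP; first by apply: bigcupT_measurable => k; have [] := P k.
  by apply: negligible_bigcup => k; apply/negligibleP; have [] := P k.
- move=> x Ax; have : [set: T] x by [].
  rewrite FT => -[k _ Fkx]; exists k => //; split => //.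
  by have [_ _ _ AE _] := P k; exact: AE.
- move=> x [[k _ [Ekx Fkx]] Ax]; exists k => //.
  by have [_ _ _ _ EN] := P k; apply: EN; split => // -[].
Qed.

(** Each superlevel set at a rational level is Borel up to a null set [N q]. Off the union of these,
    [r < f x] holds exactly when [x] lies in [E q] for some rational [q > r], a countable union of
    Borel sets. *)
Lemma caratheodory_measurable_fun_borel
    (f : caratheodory_type (mu^*)%mu -> R) : measurable_fun setT f ->
  exists N : set T, [/\ measurable N, mu N = 0 &
    measurable_fun [set: T] ((f : T -> R) \_ (~` N))].
Proof.
move=> mf.
have /choice[E /choice[N P]] (q : rat) : exists E N : set T,
    [/\ measurable E, measurable N, mu N = 0,
      [set x : T | (ratr q < f x)%R] `<=` E &
      E `\` [set x : T | (ratr q < f x)%R] `<=` N].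
  apply: caratheodory_borel.
  have := mf measurableT _ (measurable_itv `]ratr q, +oo[).
  rewrite setTI; congr (measurable _).
  by apply/seteqP; split => x /=; rewrite in_itv/= andbT.
have mN : measurable (\bigcup_q N q).
  by apply: bigcupT_measurable_rat => q; have [] := P q.
have N0 : mu (\bigcup_q N q) = 0.
  apply/negligibleP => //.
  (* The exceptional sets are reindexed by natural numbers; a code that represents no rational
     contributes the empty set. *)
  pose M k := if unpickle k is Some q then N q else set0.
  apply: (@negligibleS _ _ _ _ (\bigcup_k M k)).
    by move=> x [q _ Nx]; exists (pickle q); [exact: I|rewrite /M pickleK].
  apply: negligible_bigcup => k; rewrite /M.
  case: unpickle => [q|]; last exact: negligible_set0.
  by apply/negligibleP; have [] := P q.
exists (\bigcup_q N q); split => //.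
apply/(measurable_restrictT _ (measurableC mN)) => _.
apply: (measurability _ (RGenOInfty.measurableE R)) => //.
move=> _ [_ [r ->] <-].
rewrite (_ : _ `&` _ = ~` (\bigcup_q N q) `&`
    \bigcup_(q in [set q : rat | (r < ratr q)%R]) E q).
  apply: measurableI; first exact: measurableC.
  rewrite bigcup_mkcond; apply: bigcupT_measurable_rat => q.
  by case: ifPn => // _; have [] := P q.
apply/seteqP; split => x /= [Nx].
- rewrite in_itv/= andbT => /rat_in_itvoo[q]; rewrite in_itv/= => /andP[rq qf].
  by split => //; exists q => //; have [_ _ _ + _] := P q; apply.
- move=> [q rq Eqx]; split => //; rewrite in_itv/= andbT.
  apply: (lt_trans rq); apply: contrapT => qf; apply: Nx; exists q => //.
  by have [_ _ _ _] := P q; apply.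
exact: measurableC.
Qed.

End borel_hull.

(** Both exhaustions are taken increasing, so a point of [F i] times [G j] lies in the rectangle of
    index [maxn i j]. *)
Lemma sigma_finite_product d1 d2 (T1 : measurableType d1)
    (T2 : measurableType d2) (R : realType)
    (m1 : {sigma_finite_measure set T1 -> \bar R})
    (m2 : {sigma_finite_measure set T2 -> \bar R}) :
  sigma_finite setT (m1 \x m2)%E.
Proof.
have /sigma_finiteP[F [FT ndF Foo]] := sigma_finiteT m1.
have /sigma_finiteP[G [GT ndG Goo]] := sigma_finiteT m2.
exists (fun n => F n `*` G n).
  apply/esym/seteqP; split => // -[x y] _.
  have : [set: T1] x by []. have : [set: T2] y by [].
  rewrite FT GT => -[j _ Gy] [i _ Fx]; exists (maxn i j) => //; split => /=.
    by move: x Fx; exact/subsetPset/ndF/leq_maxl.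
  by move: y Gy; exact/subsetPset/ndG/leq_maxr.
move=> k; have [mF Fk] := Foo k; have [mG Gk] := Goo k.
split; first exact: measurableX.
by rewrite /= product_measure1E// lte_mul_pinfty// ge0_fin_numE.
Qed.

(** * Lebesgue measure: null sets of the product and product-measurable kernels *)

Section completed_lebesgue.
Context (R : realType) (d : nat).
Local Notation mu := (@borel_lebesgue R d).
Local Notation lambda := (@lebesgue_rV R d).

Lemma lebesgue_rVE (A : set 'rV[R]_d) : measurable A -> lambda A = mu A.
Proof. exact: measurable_mu_extE. Qed.

Lemma borel_lebesgue_measurable (A : set 'rV[R]_d) : measurable A ->
  measurable (A : set (@lebesgue_type R d)).
Proof. exact: caratheodory_measurable_mu_ext. Qed.

Lemma sigma_finite_lebesgue_rV :
  sigma_finite [set: @lebesgue_type R d] lambda.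
Proof.
exact: (completed_measure_extension_sigma_finite (sigma_finiteT mu)).
Qed.

HB.instance Definition _ := @Measure_isSigmaFinite.Build _ (@lebesgue_type R d)
  R lambda sigma_finite_lebesgue_rV.

#[global] Instance ae_filter_lebesgue_rV : Filter (almost_everywhere lambda) :=
  ae_filter_ringOfSetsType lambda.

Lemma lebesgue_rV_complete : measure_is_complete lambda.
Proof. exact: measure_is_complete_caratheodory. Qed.

Lemma borel_ae_lebesgue (P : set 'rV[R]_d) :
  {ae mu, forall x, P x} -> {ae lambda, forall x, P x}.
Proof.
move=> [N [mN N0 PN]]; exists N; split => //.
  exact: borel_lebesgue_measurable.
by rewrite lebesgue_rVE.
Qed.

(** The measure of [N] is the integral of the measures of its sections, and a nonnegative function
    with zero integral vanishes almost everywhere. *)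
Lemma product_null_sections (N : set ('rV[R]_d * 'rV[R]_d)) : measurable N ->
  (mu \x mu) N = 0 ->
  {ae lambda, forall x, {ae lambda, forall y, ~ N (x, y)}} /\
  {ae lambda, forall y, {ae lambda, forall x, ~ N (x, y)}}.
Proof.
move=> mN N0; split.
- apply: borel_ae_lebesgue.
  have /(ae_eq_integral_abs mu measurableT) :
      measurable_fun setT (mu \o xsection N).
    exact: measurable_fun_xsection.
  move=> [+ _]; under eq_integral do rewrite gee0_abs//.
  move=> /(_ N0); apply: filterS => x /(_ I) Nx.
  apply: borel_ae_lebesgue; exists (xsection N x); split => //.
    exact: measurable_xsection.
  by move=> y /= /contrapT; rewrite xsectionE.
- apply: borel_ae_lebesgue.
  have /(ae_eq_integral_abs mu measurableT) :
      measurable_fun setT (mu \o ysection N).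
    exact: measurable_fun_ysection.
  move=> [+ _]; under eq_integral do rewrite gee0_abs//.
  (* The product measure is defined through x-sections; its uniqueness gives the same value through
     y-sections. *)
  have -> : \int[mu]_y (mu \o ysection N) y = 0.
    rewrite -N0; apply/esym.
    apply: (product_measure_unique (m' := (mu \x^ mu)%E)) => // A B mA mB.
    by rewrite /= product_measure2E.
  move=> /(_ erefl); apply: filterS => x /(_ I) Nx.
  apply: borel_ae_lebesgue; exists (ysection N x); split => //.
    exact: measurable_ysection.
  by move=> y /= /contrapT; rewrite ysectionE.
Qed.

(* [f] is measurable only for the completed product; [g] is measurable for the
   product of the two Lebesgue sigma-algebras, to which Tonelli applies. *)
Lemma lebesgue_measurable_fun2_product (f : 'rV[R]_d * 'rV[R]_d -> R) :
  (forall p, 0 <= f p)%R -> lebesgue_measurable_fun2 f ->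
  exists g : lebesgue_type d * lebesgue_type d -> R,
    [/\ (forall p, 0 <= g p)%R, measurable_fun setT g,
     {ae lambda, forall x, {ae lambda, forall y, g (x, y) = f (x, y)}} &
     {ae lambda, forall y, {ae lambda, forall x, g (x, y) = f (x, y)}}].
Proof.
move=> f0 mf.
have [N [mN N0 mg]] :=
  caratheodory_measurable_fun_borel (sigma_finite_product mu mu) mf.
have gE p : ~ N p -> (f \_ (~` N)) p = f p by move=> Np; rewrite patchE mem_set.
have [N1 N2] := product_null_sections mN N0.
exists (f \_ (~` N)); split.
- by move=> p; rewrite patchE; case: ifP.
(* Borel sets being Lebesgue measurable, the identity carries Borel product measurability over to
   the product of the Lebesgue sigma-algebras. *)
- have mid : measurable_fun [set: @lebesgue_type R d] (id : _ -> 'rV[R]_d).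
    by move=> _ B mB; rewrite setTI; exact: borel_lebesgue_measurable.
  have mid2 : measurable_fun [set: @lebesgue_type R d * @lebesgue_type R d]
      (fun p => (p.1, p.2) : 'rV[R]_d * 'rV[R]_d).
    apply/measurable_fun_pairP; split.
      exact: (measurableT_comp mid measurable_fst).
    exact: (measurableT_comp mid measurable_snd).
  have := measurableT_comp mg mid2.
  by congr (measurable_fun _ _); apply/funext => -[].
- by apply: filterS N1 => x; apply: filterS => y /gE.
- by apply: filterS N2 => x; apply: filterS => y /gE.
Qed.

End completed_lebesgue.

(** * Integrals of nonnegative functions *)

Section integral_lemmas.
Context d (T : measurableType d) (R : realType).
Variable mu : {measure set T -> \bar R}.
Implicit Types (D : set T) (f g h k : T -> \bar R).
Import HBNNSimple.

(* The integral of a nonnegative function is by definition a supremum over the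
   simple functions below it. *)
Lemma ge0_le_integral_nomeas D f g : (forall x, D x -> 0 <= f x) ->
  (forall x, D x -> f x <= g x) ->
  \int[mu]_(x in D) f x <= \int[mu]_(x in D) g x.
Proof.
move=> f0 fg; rewrite !ge0_integralE//; last first.
  by move=> x Dx; exact: le_trans (f0 _ Dx) (fg _ Dx).
apply: ge_ereal_sup => _ [h hf <-]; apply: ereal_sup_ubound; exists h => // x.
by apply: le_trans (hf x) _; exact: lee_restrict.
Qed.

(** As [f] need not be measurable, a simple [h] below it with positive integral replaces it. If
    [h * k] had zero integral, [h] would vanish almost everywhere, since [k] is positive almost
    everywhere on [D] and [h] is zero outside [D]. *)
Lemma integral_mule_gt0 D f k : measurable D -> measurable_fun D k ->
  (forall x, D x -> 0 <= f x) -> (forall x, D x -> 0 <= k x) ->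
  {ae mu, forall x, D x -> 0 < k x} ->
  0 < \int[mu]_(x in D) f x -> 0 < \int[mu]_(x in D) (f x * k x).
Proof.
move=> mD mk f0 k0 k_gt0; rewrite {1}ge0_integralE// => /ereal_sup_gt.
move=> [_ /= [h hf <-]]; rewrite -integralT_nnsfun => h_gt0.
have fk0 x : D x -> 0 <= f x * k x by move=> Dx; rewrite mule_ge0 ?f0 ?k0.
have h0 x : 0 <= (h x)%:E by rewrite lee_fin.
have kD0 x : 0 <= (k \_ D) x by exact: erestrict_ge0.
have mh : measurable_fun setT (EFin \o h) by exact/measurable_EFinP.
have mkD : measurable_fun setT (k \_ D) by exact/(measurable_restrictT _ mD).
have mhk : measurable_fun setT (fun x => (h x)%:E * (k \_ D) x).
  exact: emeasurable_funM.
have hk_le : \int[mu]_x ((h x)%:E * (k \_ D) x) <=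
    \int[mu]_(x in D) (f x * k x).
  rewrite [leRHS]integral_mkcond; apply: ge0_le_integral_nomeas.
    by move=> x _; exact: mule_ge0.
  move=> x _; have := hf x; rewrite !patchE; case: ifPn => [xD hfx|_ _].
    by apply: lee_pmul => //; exact/k0/set_mem.
  by rewrite mule0.
apply: lt_le_trans hk_le; rewrite lt_neqAle integral_ge0 ?andbT; last first.
  by move=> x _; exact: mule_ge0.
apply/eqP => /esym hk0; move: h_gt0; rewrite lt_neqAle => /andP[/eqP + _].
apply; apply/esym.
have /(ae_eq_integral_abs mu measurableT mhk).1 hkae :
    \int[mu]_x `|(h x)%:E * (k \_ D) x| = 0.
  by rewrite -[RHS]hk0; apply: eq_integral => x _; rewrite gee0_abs// mule_ge0.
rewrite (ae_eq_integral (cst 0))// ?integral0//.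
move: hkae k_gt0; apply: filterS2 => x hkx kx _ /=.
have := hf x; have := hkx I; rewrite !patchE; case: ifPn => [xD|_ _ h_le0].
  move=> /eqP; rewrite mule_eq0 => /orP[/eqP//|/eqP k0'].
  by have := kx (set_mem xD); rewrite k0' ltxx.
by apply/eqP; rewrite eq_le h_le0 h0.
Qed.

Lemma ae_ge0_integral_le_comb D f g h (a b : R) : measurable D ->
  (0 <= a)%R -> (0 <= b)%R ->
  measurable_fun D f -> measurable_fun D g -> measurable_fun D h ->
  (forall x, D x -> 0 <= f x) -> (forall x, D x -> 0 <= g x) ->
  (forall x, D x -> 0 <= h x) ->
  {ae mu, forall x, D x -> f x <= a%:E * g x + b%:E * h x} ->
  \int[mu]_(x in D) f x <=
  a%:E * \int[mu]_(x in D) g x + b%:E * \int[mu]_(x in D) h x.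
Proof.
move=> mD a0 b0 mf mg mh f0 g0 h0 fgh.
have mag : measurable_fun D (fun x => a%:E * g x) by exact: measurable_funeM.
have mbh : measurable_fun D (fun x => b%:E * h x) by exact: measurable_funeM.
rewrite -!ge0_integralZl ?lee_fin// -ge0_integralD//; last 2 first.
- by move=> x Dx; rewrite mule_ge0 ?lee_fin// g0.
- by move=> x Dx; rewrite mule_ge0 ?lee_fin// h0.
apply: ae_ge0_le_integral => //.
- by move=> x Dx; rewrite adde_ge0// mule_ge0 ?lee_fin ?g0 ?h0.
- exact: emeasurable_funD.
Qed.

End integral_lemmas.

(** * Tonelli's theorem on rectangles and integrals of sections *)

Section tonelli.
Context d (T : measurableType d) (R : realType).
Variable mu : {sigma_finite_measure set T -> \bar R}.

Let restrictX (A B : set T) (F : T * T -> \bar R) x y : A x ->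
  (F \_ (A `*` B)) (x, y) = ((fun y => F (x, y)) \_ B) y.
Proof.
move=> Ax; rewrite !patchE; congr (if _ then _ else _).
by apply/idP/idP => /set_mem h; apply/mem_set => //; case: h.
Qed.

(** Extension by zero outside [A] times [B] reduces this to Tonelli's theorem on the whole
    product. *)
Lemma fubini_tonelli_in (A B : set T) (F : T * T -> \bar R) :
  measurable A -> measurable B -> measurable_fun setT F ->
  (forall p, 0 <= F p) ->
  \int[mu]_(x in A) \int[mu]_(y in B) F (x, y) =
  \int[mu]_(y in B) \int[mu]_(x in A) F (x, y).
Proof.
move=> mA mB mF F0; pose G := F \_ (A `*` B).
have mG : measurable_fun setT G.
  apply/(measurable_restrictT _ (measurableX mA mB)).
  exact: measurable_funS mF.
have G0 p : 0 <= G p by exact: erestrict_ge0.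
transitivity (\int[mu]_x \int[mu]_y G (x, y)).
  rewrite [LHS]integral_mkcond; apply: eq_integral => x _.
  rewrite patchE; case: ifPn => [/set_mem Ax|Ax].
    rewrite integral_mkcond; apply: eq_integral => y _.
    by rewrite /G restrictX.
  rewrite integral0_eq// => y _; rewrite /G patchE memNset// => -[/=].
  by move: Ax; rewrite notin_setE.
rewrite fubini_tonelli//.
rewrite [RHS]integral_mkcond; apply: eq_integral => y _.
rewrite patchE; case: ifPn => [/set_mem By|By].
  rewrite [RHS]integral_mkcond; apply: eq_integral => x _.
  rewrite /G !patchE; congr (if _ then _ else _).
  by apply/idP/idP => /set_mem h; apply/mem_set => //; case: h.
rewrite integral0_eq// => x _; rewrite /G patchE memNset// => -[/= _].
by move: By; rewrite notin_setE.
Qed.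

Lemma measurable_fun_integral_section (B : set T) (F : T * T -> \bar R) :
  measurable B -> measurable_fun setT F -> (forall p, 0 <= F p) ->
  measurable_fun setT (fun x => \int[mu]_(y in B) F (x, y)).
Proof.
move=> mB mF F0; pose G := F \_ (setT `*` B).
have mG : measurable_fun setT G.
  apply/(measurable_restrictT _ (measurableX measurableT mB)).
  exact: measurable_funS mF.
have G0 p : 0 <= G p by exact: erestrict_ge0.
rewrite (_ : (fun _ => _) = fubini_F mu G).
  exact: measurable_fun_fubini_tonelli_F.
apply/funext => x; rewrite integral_mkcond; apply: eq_integral => y _.
by rewrite /G restrictX.
Qed.

Lemma measurable_fun_pairl d' (T' : measurableType d') (F : T * T -> T') x :
  measurable_fun setT F -> measurable_fun setT (fun y => F (x, y)).
Proof. by move=> mF; exact: (measurableT_comp mF (pair1_measurable x)). Qed.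

Hypothesis mu_complete : measure_is_complete mu.

(** Only [F] is assumed measurable: completeness makes almost every section of [f] measurable,
    because it agrees almost everywhere with that of [F]. *)
Lemma ae_eq_integral_section (B : set T) (f F : T * T -> \bar R) :
  measurable B -> measurable_fun setT F ->
  {ae mu, forall x, {ae mu, forall y, B y -> F (x, y) = f (x, y)}} ->
  {ae mu, forall x, \int[mu]_(y in B) F (x, y) = \int[mu]_(y in B) f (x, y)}.
Proof.
move=> mB mF; apply: filterS => x Ff.
have mFx : measurable_fun B (fun y => F (x, y)).
  by apply/measurable_funTS; exact: measurable_fun_pairl.
apply: ae_eq_integral => //.
exact: (ae_measurable_fun mu_complete Ff).
Qed.

End tonelli.

(** * Estimates for a product-measurable kernel *)

(** The two sides differ by [(a * s - t) ^+ 2]. This serves both for the closure of the spaces under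
    linear combinations and, with [a = -1], for the trace estimate. *)
Lemma sqr_comb_le (R : realDomainType) (a s t : R) :
  ((a * s + t) ^+ 2 <= 2 * a ^+ 2 * s ^+ 2 + 2 * t ^+ 2)%R.
Proof.
rewrite -subr_ge0 (_ : (_ - _)%R = ((a * s - t) ^+ 2)%R) ?sqr_ge0//.
by rewrite !expr2; ring.
Qed.

Lemma measurable_fun_comb d (T : measurableType d) (R : realType) (D : set T)
    (a : R) (u v : T -> R) : measurable_fun D u -> measurable_fun D v ->
  measurable_fun D (fun x => a * u x + v x)%R.
Proof.
by move=> meas_u mv; apply: measurable_funD => //; exact: measurable_funM.
Qed.

Lemma weighted_sqr_integral_comb_lty d (T : measurableType d) (R : realType)
    (mu : {measure set T -> \bar R}) (D : set T) (w : T -> \bar R) (a : R)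
    (u v : T -> R) :
  measurable D -> measurable_fun D w -> (forall y, 0 <= w y) ->
  measurable_fun D u -> measurable_fun D v ->
  \int[mu]_(y in D) ((u y ^+ 2)%:E * w y) < +oo ->
  \int[mu]_(y in D) ((v y ^+ 2)%:E * w y) < +oo ->
  \int[mu]_(y in D) (((a * u y + v y) ^+ 2)%:E * w y) < +oo.
Proof.
move=> mD mw w0 meas_u mv u_fin v_fin.
have L0 f : 0 <= \int[mu]_(y in D) ((f y ^+ 2)%:E * w y).
  by apply: integral_ge0 => y _; rewrite mule_ge0// lee_fin sqr_ge0.
have mL (f : T -> R) : measurable_fun D f ->
    measurable_fun D (fun y => (f y ^+ 2)%:E * w y).
  move=> mf; apply: emeasurable_funM => //.
  by apply/measurable_EFinP; exact: measurable_funX.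
have a2 : (0 <= 2 * a ^+ 2 :> R)%R by rewrite mulr_ge0// sqr_ge0.
have L_le : \int[mu]_(y in D) (((a * u y + v y) ^+ 2)%:E * w y) <=
    (2 * a ^+ 2)%:E * \int[mu]_(y in D) ((u y ^+ 2)%:E * w y) +
    2%:E * \int[mu]_(y in D) ((v y ^+ 2)%:E * w y).
  apply: ae_ge0_integral_le_comb => //;
    try by move=> y _; rewrite mule_ge0// lee_fin sqr_ge0.
  - exact/mL/measurable_fun_comb.
  - exact: mL.
  - exact: mL.
  - apply: aeW => y _; rewrite !muleA -ge0_muleDl -?EFinM ?lee_fin//;
      try by rewrite mulr_ge0// sqr_ge0.
    by rewrite lee_wpmul2r// -EFinD lee_fin sqr_comb_le.
apply: le_lt_trans L_le _.
by rewrite lte_add_pinfty// lte_mul_pinfty.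
Qed.

Section kernel_estimates.
Context d (T : measurableType d) (R : realType).
Variable mu : {sigma_finite_measure set T -> \bar R}.
Variables (Omega : set T) (g : T * T -> R).
Hypotheses (mOmega : measurable Omega) (g0 : forall p, (0 <= g p)%R)
  (mg : measurable_fun setT g).

Lemma measurable_fun_kernel_diff (v : T -> R) : measurable_fun setT v ->
  measurable_fun setT
    (fun p : T * T => ((v p.1 - v p.2) ^+ 2 * g (p.2, p.1))%:E).
Proof.
move=> mv; apply/measurable_EFinP/measurable_funM.
  apply: measurable_funX; apply: measurable_funB.
    exact: (measurableT_comp mv measurable_fst).
  exact: (measurableT_comp mv measurable_snd).
exact: (measurableT_comp mg (@measurable_swap _ _ T T)).
Qed.

Let diff_ge0 (v : T -> R) (x y : T) :
  0 <= ((v x - v y) ^+ 2 * g (y, x))%:E.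
Proof. by rewrite lee_fin mulr_ge0// sqr_ge0. Qed.

Let measurable_diff (v : T -> R) x : measurable_fun setT v ->
  measurable_fun setT (fun y => ((v x - v y) ^+ 2 * g (y, x))%:E).
Proof.
by move=> mv; exact: measurable_fun_pairl (measurable_fun_kernel_diff mv).
Qed.

Lemma measurable_fun_diff_integral (D : set T) (v : T -> R) :
  measurable D -> measurable_fun setT v ->
  measurable_fun setT
    (fun x => \int[mu]_(y in D) ((v x - v y) ^+ 2 * g (y, x))%:E).
Proof.
move=> mD mv.
apply: (measurable_fun_integral_section mu mD (measurable_fun_kernel_diff mv)).
by move=> -[x y]; exact: diff_ge0.
Qed.

Let diff_integral_ge0 (D : set T) (v : T -> R) (x : T) :
  0 <= \int[mu]_(y in D) ((v x - v y) ^+ 2 * g (y, x))%:E.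
Proof. by apply: integral_ge0 => y _; exact: diff_ge0. Qed.

Let measurable_sqr (v : T -> R) (D : set T) : measurable_fun setT v ->
  measurable_fun D (fun x => (v x ^+ 2)%:E).
Proof.
by move=> mv; apply/measurable_EFinP/measurable_funTS; exact: measurable_funX.
Qed.

(** This is [V_norm_sq] over an abstract measure space, with the kernel as a parameter so that the
    values for [gamma] and its product-measurable replacement can be compared. *)
Definition energy (w : T -> R) : \bar R :=
  \int[mu]_(x in Omega) (w x ^+ 2)%:E +
  \int[mu]_(x in Omega) \int[mu]_y ((w x - w y) ^+ 2 * g (y, x))%:E.

(** The increments of [a * u + v] are [a] times those of [u] plus those of [v], so [sqr_comb_le]
    bounds the local and the nonlocal term alike. *)
Lemma energy_comb_le (a : R) (u v : T -> R) :
  measurable_fun setT u -> measurable_fun setT v ->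
  energy (fun x => a * u x + v x)%R <=
  (2 * a ^+ 2)%:E * energy u + 2%:E * energy v.
Proof.
move=> meas_u mv.
have a2 : (0 <= 2 * a ^+ 2 :> R)%R by rewrite mulr_ge0// sqr_ge0.
have muv : measurable_fun setT (fun x => a * u x + v x)%R.
  by apply: measurable_funD => //; exact: measurable_funM.
have sqr0 w : 0 <= \int[mu]_(x in Omega) (w x ^+ 2)%:E.
  by apply: integral_ge0 => x _; rewrite lee_fin sqr_ge0.
have diff0 w : 0 <= \int[mu]_(x in Omega) \int[mu]_y
    ((w x - w y) ^+ 2 * g (y, x))%:E by exact: integral_ge0.
rewrite /energy (ge0_muleDr _ (sqr0 u) (diff0 u)).
rewrite (ge0_muleDr _ (sqr0 v) (diff0 v)).
rewrite [leRHS]addeACA; apply: leeD.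
  apply: ae_ge0_integral_le_comb => //; try exact: measurable_sqr;
    try by move=> x _; rewrite lee_fin sqr_ge0.
  by apply: aeW => x _; rewrite -!EFinM -EFinD lee_fin sqr_comb_le.
apply: ae_ge0_integral_le_comb => //;
  try (apply/measurable_funTS; exact: measurable_fun_diff_integral);
  try by move=> x _; exact: diff_integral_ge0.
apply: aeW => x _; apply: ae_ge0_integral_le_comb => //;
  try exact: measurable_diff;
    try by move=> y _; rewrite lee_fin mulr_ge0// sqr_ge0.
apply: aeW => y _; rewrite -!EFinM -EFinD lee_fin !mulrA -mulrDl.
apply: ler_wpM2r => //.
have := sqr_comb_le a (u x - u y) (v x - v y).
rewrite (_ : a * (u x - u y) + _ = a * u x + v x - (a * u y + v y))%R;
  last by ring.
by rewrite !expr2 !mulrA.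
Qed.

(* Tonelli turns the left-hand side into an integral over [Omega] first, where
   [v y ^+ 2 <= 2 (v x - v y) ^+ 2 + 2 v x ^+ 2]; the weight [K] controls the
   first term by its upper bound [C] and the second one by [K x * G x <= 1],
   [G x] being the mass of [g (_, x)] over [D]. *)
Lemma weighted_trace_le (D : set T) (K : T -> R) (C : R) (v : T -> R) :
  measurable D -> measurable_fun setT K ->
  (forall x, 0 <= K x)%R -> (0 <= C)%R ->
  {ae mu, forall x, Omega x -> (K x <= C)%R /\
    (K x)%:E * \int[mu]_(y in D) (g (y, x))%:E <= 1} ->
  measurable_fun setT v ->
  \int[mu]_(y in D)
    ((v y ^+ 2)%:E * \int[mu]_(x in Omega) (g (y, x) * K x)%:E) <=
  (2 * C)%:E * \int[mu]_(x in Omega) \int[mu]_y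
    ((v x - v y) ^+ 2 * g (y, x))%:E +
  2%:E * \int[mu]_(x in Omega) (v x ^+ 2)%:E.
Proof.
move=> mD mK K0 C0 KC mv.
pose F (p : T * T) := (v p.1 ^+ 2 * (g p * K p.2))%:E.
have F0 p : 0 <= F p by rewrite lee_fin mulr_ge0 ?sqr_ge0// mulr_ge0.
have mF : measurable_fun setT F.
  apply/measurable_EFinP/measurable_funM.
    by apply: measurable_funX; exact: (measurableT_comp mv measurable_fst).
  by apply: measurable_funM => //; exact: (measurableT_comp mK measurable_snd).
have mgK y : measurable_fun setT (fun x => (g (y, x) * K x)%:E).
  apply/measurable_EFinP/measurable_funM => //.
  exact: measurable_fun_pairl mg.
have mgx x : measurable_fun setT (fun y => (g (y, x))%:E).
  apply/measurable_EFinP.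
  exact: (measurableT_comp mg (pair2_measurable x)).
rewrite (eq_integral (fun y => \int[mu]_(x in Omega) F (y, x))); last first.
  move=> y _; rewrite -ge0_integralZl//.
  - exact: measurable_funTS.
  - by move=> x _; rewrite lee_fin mulr_ge0.
  - by rewrite lee_fin sqr_ge0.
rewrite fubini_tonelli_in//.
apply: ae_ge0_integral_le_comb => //.
- by rewrite mulr_ge0.
- apply/measurable_funTS.
  apply: (measurable_fun_integral_section mu mD
    (F := fun p => F (p.2, p.1))) => //.
  exact: (measurableT_comp mF (@measurable_swap _ _ T T)).
- by apply/measurable_funTS; exact: measurable_fun_diff_integral.
- exact: measurable_sqr.
- by move=> x _; exact: integral_ge0.
- by move=> x _; rewrite lee_fin sqr_ge0.
apply: filterS KC => x KC /KC [KxC KG].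
(* For fixed [x], the splitting of [v y ^+ 2] is integrated in [y] over [D], with [K x] kept as a
   factor of both terms. *)
apply: (@le_trans _ _ ((2 * K x)%:E *
    \int[mu]_(y in D) ((v x - v y) ^+ 2 * g (y, x))%:E +
    (2 * v x ^+ 2 * K x)%:E * \int[mu]_(y in D) (g (y, x))%:E)).
  apply: ae_ge0_integral_le_comb => //.
  - by rewrite mulr_ge0.
  - by rewrite mulr_ge0// mulr_ge0// sqr_ge0.
  - apply/measurable_funTS.
    exact: (measurableT_comp mF (pair2_measurable x)).
  - by apply/measurable_funTS; exact: measurable_diff.
  - exact/measurable_funTS.
  - by move=> y _; rewrite lee_fin.
  - apply: aeW => y _; rewrite /F/= -!EFinM -EFinD lee_fin.
    rewrite (_ : (_ + _)%R =
      ((2 * (v x - v y) ^+ 2 + 2 * v x ^+ 2) * (g (y, x) * K x))%R);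
      last by ring.
    apply: ler_wpM2r; first by rewrite mulr_ge0.
    have := sqr_comb_le (-1) (v x - v y) (v x).
    rewrite (_ : (-1 * (v x - v y) + v x)%R = v y); last by ring.
    by rewrite sqrrN expr1n mulr1.
apply: leeD.
  (* In the first term [K x] is replaced by [C] and [D] is enlarged to the whole space. *)
  apply: lee_pmul => //.
  - by rewrite lee_fin mulr_ge0.
  - by rewrite lee_fin ler_wpM2l.
  - apply: ge0_subset_integral => //.
    exact: measurable_diff.
rewrite EFinM -muleA -[leRHS]mule1 EFinM; apply: lee_wpmul2l => //.
by rewrite lee_fin mulr_ge0// sqr_ge0.
Qed.

End kernel_estimates.

(** * The trace weight and the trace inequality for the original kernel *)

Section trace_kernel.
Context d (T : measurableType d) (R : realType).
Variable mu : {sigma_finite_measure set T -> \bar R}.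
Variables (Omega : set T) (gamma g : T * T -> R) (c delta : R).
Hypotheses (mu_complete : measure_is_complete mu) (mOmega : measurable Omega)
  (gamma0 : forall p, (0 <= gamma p)%R) (g0 : forall p, (0 <= g p)%R)
  (mg : measurable_fun setT g)
  (g_gamma1 : {ae mu, forall y, {ae mu, forall x, g (y, x) = gamma (y, x)}})
  (g_gamma2 : {ae mu, forall x, {ae mu, forall y, g (y, x) = gamma (y, x)}})
  (c0 : (0 <= c)%R) (delta0 : (0 < delta)%R).

Let Gamma := [set y | ~ Omega y /\ 0 < \int[mu]_(x in Omega) (gamma (y, x))%:E].
Let mass x := \int[mu]_(z in Gamma) (gamma (z, x))%:E.
Let w y := \int[mu]_(x in Omega) ((gamma (y, x))%:E / (mass x + c%:E)).

Hypotheses (mass_fin : {ae mu, forall x, Omega x -> mass x < +oo})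
  (mass_ge : {ae mu, forall x, Omega x -> delta%:E <= mass x + c%:E}).

Let mgE : measurable_fun setT (EFin \o g).
Proof. exact/measurable_EFinP. Qed.

Let mgsE : measurable_fun setT (fun p : T * T => (g (p.2, p.1))%:E).
Proof. exact: (measurableT_comp mgE (@measurable_swap _ _ T T)). Qed.

(** Apart from excluding [Omega], this is a superlevel set of a function that agrees almost
    everywhere with the measurable section integral of [g]; completeness makes it measurable. *)
Lemma measurable_kernel_boundary : measurable Gamma.
Proof.
rewrite (_ : Gamma = ~` Omega `&`
    (setT `&` [set y | 0 < \int[mu]_(x in Omega) (gamma (y, x))%:E])).
  apply: measurableI; first exact: measurableC.
  apply: emeasurable_fun_o_infty => //.
  apply: (ae_measurable_fun mu_complete
    (f := fun y => \int[mu]_(x in Omega) (g (y, x))%:E)).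
    have := ae_eq_integral_section mu_complete (f := EFin \o gamma) mOmega mgE.
    move=> h; apply: filterS (h _) => [y /= -> //|].
    by apply: filterS g_gamma1 => y; apply: filterS => x /= ->.
  apply: (measurable_fun_integral_section mu mOmega mgE) => p.
  by rewrite lee_fin.
by apply/seteqP; split => [y [? ?]|y [? []]].
Qed.
Let mGamma := measurable_kernel_boundary.

Let mass' x := \int[mu]_(z in Gamma) (g (z, x))%:E.

Let mass_ge0 x : 0 <= mass x.
Proof. by apply: integral_ge0 => z _; rewrite lee_fin. Qed.

Let measurable_mass' : measurable_fun setT mass'.
Proof.
apply: (measurable_fun_integral_section mu mGamma mgsE) => p.
by rewrite lee_fin.
Qed.

Let mass'E : {ae mu, forall x, mass' x = mass x}.
Proof.
have h := ae_eq_integral_section mu_complete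
  (f := fun p => (gamma (p.2, p.1))%:E) mGamma mgsE.
apply: h; apply: filterS g_gamma2 => x; apply: filterS => y /= -> //.
Qed.

(** A real-valued version of [1 / (mass x + c)], nonnegative and measurable everywhere. [fine] sends
    an infinite mass to zero, which for points of [Omega] happens only on a null set. *)
Let K x := ((fine (mass' x) + c) `^ (-1))%R.

Let K0 x : (0 <= K x)%R. Proof. exact: powR_ge0. Qed.

Let measurable_K : measurable_fun setT K.
Proof.
apply: (measurableT_comp (measurable_powR (-1))).
apply: measurable_funD => //.
exact: (measurableT_comp (@fine_measurable R setT measurableT)
  measurable_mass').
Qed.

(** For almost every [x] in [Omega] the mass is a real [m >= 0] with [delta <= m + c]. Then
    [m / (m + c) <= 1] because [c] is nonnegative. *)
Let KP : {ae mu, forall x, Omega x -> [/\ (0 < K x)%R, (K x <= delta^-1)%R,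
  (K x)%:E * mass' x <= 1 & (mass x + c%:E)^-1 = (K x)%:E]}.
Proof.
move: mass'E mass_fin mass_ge; apply: filterS3 => x massE fin ge Omx.
have {}fin := fin Omx; have {}ge := ge Omx.
have := mass_ge0 x; rewrite /K massE.
case: (mass x) fin ge => // m _; rewrite -EFinD !lee_fin /= => delta_le m0.
have mc0 : (0 < m + c)%R by exact: lt_le_trans delta_le.
rewrite powR_inv1; last exact: ltW.
split.
- by rewrite invr_gt0.
- by rewrite lef_pV2// posrE.
- by rewrite mulrC ler_pdivrMr ?mul1r ?lerDl.
- by rewrite inver gt_eqF.
Qed.

Let measurable_gK y : measurable_fun setT (fun x => (g (y, x) * K x)%:E).
Proof.
apply/measurable_EFinP/measurable_funM => //; exact: measurable_fun_pairl mg.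
Qed.

Let measurable_weight' :
  measurable_fun setT (fun y => \int[mu]_(x in Omega) (g (y, x) * K x)%:E).
Proof.
apply: (measurable_fun_integral_section mu mOmega
  (F := fun p : T * T => (g p * K p.2)%:E)).
  apply/measurable_EFinP/measurable_funM => //.
  exact: (measurableT_comp measurable_K measurable_snd).
by move=> p; rewrite lee_fin mulr_ge0.
Qed.

Let weight'E : {ae mu, forall y,
  \int[mu]_(x in Omega) (g (y, x) * K x)%:E = w y}.
Proof.
move: g_gamma1; apply: filterS => y gy.
have ae : ae_eq mu Omega (fun x => (g (y, x) * K x)%:E)
    (fun x => (gamma (y, x))%:E / (mass x + c%:E)).
  by move: gy KP; apply: filterS2 => x -> h /h[_ _ _ ->]; rewrite -EFinM.
apply: ae_eq_integral => //; first exact: measurable_funTS.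
by apply: (ae_measurable_fun mu_complete ae); exact: measurable_funTS.
Qed.

Lemma measurable_kernel_weight : measurable_fun setT w.
Proof.
apply: (ae_measurable_fun mu_complete _ measurable_weight').
by apply: filterS weight'E => y ->.
Qed.

Let inv_mass_ge0 x : 0 <= (mass x + c%:E)^-1.
Proof. by rewrite inve_ge0 adde_ge0// lee_fin. Qed.

Lemma kernel_weight_ge0 y : 0 <= w y.
Proof. by apply: integral_ge0 => x _; rewrite mule_ge0// lee_fin. Qed.

(** [integral_mule_gt0] asks for measurability of the factor [1 / (mass x + c)] only, so the section
    of [gamma] at [y] may be arbitrary. *)
Lemma kernel_weight_gt0 y : Gamma y -> 0 < w y.
Proof.
move=> [_]; apply: integral_mule_gt0 => //.
- apply: (ae_measurable_fun mu_complete (f := EFin \o K)).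
    by apply: filterS KP => x h /h[_ _ _ ->].
  by apply/measurable_funTS/measurable_EFinP.
- by move=> x _; rewrite lee_fin.
- by apply: filterS KP => x h /h[K_gt0 _ _ ->]; rewrite lte_fin.
Qed.

(** For almost every [x] the functions [g (_, x)] and [gamma (_, x)] agree almost everywhere, so the
    inner integrals coincide. *)
Lemma ae_eq_energy (v : T -> R) : measurable_fun setT v ->
  energy mu Omega g v = energy mu Omega gamma v.
Proof.
move=> mv; congr (_ + _).
have ae : {ae mu, forall x,
    \int[mu]_y ((v x - v y) ^+ 2 * g (y, x))%:E =
    \int[mu]_y ((v x - v y) ^+ 2 * gamma (y, x))%:E}.
  have h := ae_eq_integral_section mu_complete
    (f := fun p => ((v p.1 - v p.2) ^+ 2 * gamma (p.2, p.1))%:E) measurableT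
    (measurable_fun_kernel_diff mg mv).
  by apply: h; apply: filterS g_gamma2 => x; apply: filterS => y /= ->.
have mI := measurable_fun_diff_integral mu g0 mg measurableT mv.
apply: ae_eq_integral => //; first exact: measurable_funTS.
  apply: measurable_funTS; apply: (ae_measurable_fun mu_complete _ mI).
  by apply: filterS ae => x ->.
by apply: filterS ae => x ->.
Qed.

Lemma kernel_trace_le (v : T -> R) : measurable_fun setT v ->
  \int[mu]_(y in Gamma) ((v y ^+ 2)%:E * w y) <=
  (2 * delta^-1 + 2)%:E * energy mu Omega gamma v.
Proof.
move=> mv; rewrite -ae_eq_energy//.
have mv2 : measurable_fun Gamma (fun y => (v y ^+ 2)%:E).
  by apply/measurable_EFinP/measurable_funTS; exact: measurable_funX.
have delta1 : (0 <= delta^-1)%R by rewrite invr_ge0 ltW.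
rewrite (ae_eq_integral
    (fun y => (v y ^+ 2)%:E * \int[mu]_(x in Omega) (g (y, x) * K x)%:E))//;
  last 3 first.
- apply: emeasurable_funM => //; apply: measurable_funTS.
  exact: measurable_kernel_weight.
- by apply: emeasurable_funM => //; exact: measurable_funTS.
- by apply: filterS weight'E => y -> _.
have KP' : {ae mu, forall x, Omega x -> (K x <= delta^-1)%R /\
    (K x)%:E * \int[mu]_(y in Gamma) (g (y, x))%:E <= 1}.
  by apply: filterS KP => x h /h[].
apply: le_trans
  (weighted_trace_le mOmega g0 mg mGamma measurable_K K0 delta1 KP' mv) _.
have s0 : 0 <= \int[mu]_(x in Omega) (v x ^+ 2)%:E.
  by apply: integral_ge0 => x _; rewrite lee_fin sqr_ge0.
have d0 : 0 <= \int[mu]_(x in Omega) \int[mu]_y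
    ((v x - v y) ^+ 2 * g (y, x))%:E.
  apply: integral_ge0 => x _; apply: integral_ge0 => y _.
  by rewrite lee_fin mulr_ge0// sqr_ge0.
(* The constant [2 / delta + 2] dominates both coefficients of the estimate, [2 / delta] and [2]. *)
rewrite /energy (ge0_muleDr _ s0 d0) addeC; apply: leeD.
  by rewrite lee_wpmul2r// lee_fin lerDr mulr_ge0.
by rewrite lee_wpmul2r// lee_fin lerDl.
Qed.

(* The trace estimate applied to [v = 1]. *)
Lemma kernel_weight_negligible : mu Omega < +oo ->
  mu.-negligible [set y | Gamma y /\ w y = +oo].
Proof.
move=> Omega_fin.
have : \int[mu]_(y in Gamma) `|w y| < +oo.
  have := @kernel_trace_le (cst 1%R) (measurable_cst _).
  rewrite (eq_integral (fun y => `|w y|)); last first.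
    by move=> y _; rewrite expr1n mul1e gee0_abs// kernel_weight_ge0.
  move=> /le_lt_trans; apply; rewrite lte_mul_pinfty ?lee_fin//.
    by rewrite addr_ge0// mulr_ge0// invr_ge0 ltW.
  (* The increments of a constant vanish, so its energy is the measure of [Omega]. *)
  rewrite /energy [X in _ + X](_ : _ = 0) ?adde0.
    by under eq_integral do rewrite expr1n; rewrite integral_cst// mul1e.
  rewrite integral0_eq// => x _; rewrite integral0_eq// => y _.
  by rewrite subrr expr0n mul0r.
move=> w_fin; have : mu.-integrable Gamma w.
  by apply/integrableP; split => //; apply: measurable_funTS;
    exact: measurable_kernel_weight.
move=> /(integrable_ae mGamma)[N [mN N0 wN]]; exists N; split => //.
by move=> y [Gy wy]; apply: wN => /= /(_ Gy); rewrite wy.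
Qed.

End trace_kernel.

(** * Euclidean space *)

Section row_vectors.
Context (R : realType) (d : nat).

(** An open set is the union of the half-open boxes with rational endpoints that it contains, and
    there are countably many of these. *)
Lemma open_measurable_rV (A : set 'rV[R]_d) : open A -> measurable A.
Proof.
move=> oA.
pose box (q : {ffun 'I_d -> rat * rat}) := [set x : 'rV[R]_d |
  forall i, x ord0 i \in `]ratr (q i).1, ratr (q i).2]%R].
rewrite (_ : A = \bigcup_(q in [set q | box q `<=` A]) box q).
  rewrite bigcup_mkcond; apply: countable_bigcupT_measurable => [|q].
    exact: countableP.
  by case: ifP => // _; exact: measurable_rV_box.
apply/seteqP; split => [x Ax|x [q]]; last exact.
have /nbhs_ballP[e /= e0 xeA] : nbhs x A by exact: open_nbhs_nbhs.
(* Endpoints within [e] of each coordinate keep the box inside the ball, which is a ball of the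
   maximum norm. *)
have /choice[q Pq] (i : 'I_d) : exists q : rat * rat,
    (x ord0 i - e < ratr q.1 < x ord0 i)%R /\
    (x ord0 i < ratr q.2 < x ord0 i + e)%R.
  have /rat_in_itvoo[q1 q1P] : (x ord0 i - e < x ord0 i)%R.
    by rewrite ltrBlDr ltrDl.
  have /rat_in_itvoo[q2 q2P] : (x ord0 i < x ord0 i + e)%R by rewrite ltrDl.
  by exists (q1, q2); rewrite !in_itv/= in q1P q2P.
exists [ffun i => q i] => [y yq|i].
  apply: xeA; split => // i j; rewrite (ord1 i).
  have := yq j; rewrite ffunE in_itv/= => /andP[qy yq'].
  have [/andP[q1 _] /andP[_ q2]] := Pq j.
  by rewrite /ball/= ltr_norml; apply/andP; split; lra.
have [/andP[_ q1] /andP[q2 _]] := Pq i.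
by rewrite ffunE in_itv/= q1 ltW.
Qed.

Lemma bounded_lebesgue_rV_lty (A : set 'rV[R]_d) : bounded_set A ->
  measurable A -> lebesgue_rV d A < +oo.
Proof.
move=> /pinfty_ex_gt0[M M0 AM] mA.
(* The boxes are open on the left, so the lower end is moved to [-M - 1] to include the coordinate
   value [-M]. *)
pose B := [set x : 'rV[R]_d | forall i, x ord0 i \in `](- M - 1)%R, M]].
have mB : measurable B.
  exact: (measurable_rV_box (fun=> - M - 1)%R (fun=> M)).
have AB : A `<=` B.
  move=> x /AM xM i.
  have : (`|x ord0 i| <= M)%R.
    apply: le_trans xM; rewrite [leRHS]/Num.Def.normr/= mx_normrE.
    by apply/bigmax_geP; right; exists (ord0, i).
  by rewrite ler_norml in_itv/= => /andP[Mx ->]; rewrite andbT; lra.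
apply: (@le_lt_trans _ _ (lebesgue_rV d B)); first exact: le_mu_ext.
rewrite lebesgue_rVE// borel_lebesgue_box ?ltry// => i; lra.
Qed.

End row_vectors.

Lemma ess_inf_shift_gt0 (R : realType) (d : nat) (D : set 'rV[R]_d)
    (f : 'rV[R]_d -> \bar R) (c : R) : 0 < ess_inf_on D f + c%:E ->
  exists2 delta : R, (0 < delta)%R &
    {ae lebesgue_rV d, forall x, D x -> delta%:E <= f x + c%:E}.
Proof.
move=> pos.
have [delta delta0 le] : exists2 delta : R, (0 < delta)%R &
    delta%:E <= ess_inf_on D f + c%:E.
  (* A finite essential infimum gives its sum with [c]; if it is infinite any positive number will
     do, here 1. *)
  case: (ess_inf_on D f) pos => [r| |//].
    by rewrite -EFinD lte_fin => rc; exists (r + c)%R.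
  by exists 1%R => //; rewrite addye// leey.
exists delta => //.
have := ess_inf_le (lebesgue_rV d)
  (patch (cst +oo) D f : lebesgue_type d -> \bar R).
apply: filterS => x; rewrite -/(ess_inf_on D f) /patch => + Dx.
by rewrite mem_set// => fx; apply: le_trans le _; exact: leeD2r.
Qed.

Lemma sqrte_lt_sqr (R : realType) (x : \bar R) (r : R) : 0 <= x -> (0 < r)%R ->
  (sqrte x < r%:E) = (x < (r ^+ 2)%:E).
Proof.
move=> x0 r0; rewrite -[r in LHS]ger0_norm ?ltW// -sqrtr_sqr.
by rewrite -[X in _ < X]/(sqrte (r ^+ 2)%:E) ltNge lee_sqrt// -ltNge.
Qed.

(** * Positivity and finiteness of the weight, and continuity of the trace operator *)

Unset Implicit Arguments.
Set Strict Implicit.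

Theorem theorem5p1 (R : realType) (d : nat) (Omega : set 'rV[R]_d)
    (gamma : 'rV[R]_d * 'rV[R]_d -> R) (c : R)
    (Omega_bounded : bounded_set Omega) (Omega_neq0 : Omega !=set0)
    (Omega_open : open Omega)
    (gamma_ge0 : forall p, (0 <= gamma p)%R)
    (gamma_meas : lebesgue_measurable_fun2 gamma)
    (gamma_fin : {ae lebesgue_rV d, forall x, Omega x ->
      \int[lebesgue_rV d]_(z in nonlocal_boundary Omega gamma)
        (gamma (z, x))%:E < +oo})
    (c_ge0 : (0 <= c)%R)
    (c_pos : 0 < ess_inf_on Omega (fun x =>
      \int[lebesgue_rV d]_(y in nonlocal_boundary Omega gamma)
        (gamma (y, x))%:E) + c%:E) :
  [/\ forall y, nonlocal_boundary Omega gamma y ->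
        0 < trace_weight Omega gamma c y,
      (lebesgue_rV d).-negligible
        [set y | nonlocal_boundary Omega gamma y /\
                 trace_weight Omega gamma c y = +oo] &
      continuous_linear_operator (V_space Omega gamma)
        (L2_space (nonlocal_boundary Omega gamma)
                  (trace_weight Omega gamma c))
        (trace Omega gamma)].
Proof.
set lam := lebesgue_rV d.
have mOmega : measurable (Omega : set (lebesgue_type d)).
  by apply: borel_lebesgue_measurable; exact: open_measurable_rV.
have [delta delta0 mass_ge] := ess_inf_shift_gt0 c_pos.
have [g [g0 mg g_gamma1 g_gamma2]] :=
  lebesgue_measurable_fun2_product gamma_ge0 gamma_meas.
set Gamma := nonlocal_boundary Omega gamma.
set w := trace_weight Omega gamma c.
have complete := @lebesgue_rV_complete R d.
have mGamma : measurable (Gamma : set (lebesgue_type d)).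
  exact: (measurable_kernel_boundary complete mOmega g0 mg g_gamma1).
have mw : measurable_fun [set: lebesgue_type d] (w : lebesgue_type d -> \bar R).
  exact: (measurable_kernel_weight complete mOmega gamma_ge0 g0 mg
    g_gamma1 g_gamma2 c_ge0 delta0 gamma_fin mass_ge).
have w0 y : 0 <= w y by exact: (kernel_weight_ge0 lam Omega gamma_ge0 c_ge0).
have V0 v : 0 <= V_norm_sq Omega gamma v.
  by rewrite /V_norm_sq adde_ge0//; apply: integral_ge0 => x _;
    [rewrite lee_fin sqr_ge0|apply: integral_ge0 => y _;
     rewrite lee_fin mulr_ge0// sqr_ge0].
have L0 v : 0 <= L2_norm_sq Gamma w v.
  by apply: integral_ge0 => y _; rewrite mule_ge0// lee_fin sqr_ge0.
pose M := (2 * delta^-1 + 2)%R.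
have M1 : (1 <= M)%R.
  have : (0 < delta^-1)%R by rewrite invr_gt0.
  by rewrite /M; lra.
have L_le v : lebesgue_measurable_fun setT v ->
    L2_norm_sq Gamma w v <= M%:E * V_norm_sq Omega gamma v.
  exact: (kernel_trace_le complete mOmega gamma_ge0 g0 mg
    g_gamma1 g_gamma2 c_ge0 delta0 gamma_fin mass_ge).
have traceE v y : Gamma y -> trace Omega gamma v y = v y.
  by move=> Gy; rewrite /trace patchE mem_set.
have L_traceE v :
    L2_norm_sq Gamma w (trace Omega gamma v) = L2_norm_sq Gamma w v.
  by apply: eq_integral => y /set_mem Gy; rewrite traceE.
have L_trace_subE u v : L2_norm_sq Gamma w
    (fun y => trace Omega gamma v y - trace Omega gamma u y)%R =
    L2_norm_sq Gamma w (fun y => v y - u y)%R.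
  by apply: eq_integral => y /set_mem Gy; rewrite !traceE.
have V_comb a u v : fs_carrier (V_space Omega gamma) u ->
    fs_carrier (V_space Omega gamma) v ->
    fs_carrier (V_space Omega gamma) (fun x => a * u x + v x)%R.
  move=> [meas_u u_fin] [mv v_fin].
  have a2 : (0 <= 2 * a ^+ 2 :> R)%R by rewrite mulr_ge0// sqr_ge0.
  (* The energy is computed with the kernel [g], to which [energy_comb_le] applies. *)
  have energyE f : lebesgue_measurable_fun setT f ->
      energy lam Omega g f = V_norm_sq Omega gamma f.
    exact: (ae_eq_energy complete mOmega g0 mg g_gamma2).
  have mcomb := measurable_fun_comb a meas_u mv.
  split; first exact: mcomb.
  rewrite /= -energyE; last exact: mcomb.
  apply: le_lt_trans (energy_comb_le lam mOmega g0 mg a meas_u mv) _.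
  by rewrite (energyE u meas_u) (energyE v mv) lte_add_pinfty// lte_mul_pinfty.
split.
- move=> y; exact: (kernel_weight_gt0 complete mOmega gamma_ge0 g0 mg
    g_gamma1 g_gamma2 c_ge0 delta0 gamma_fin mass_ge).
- apply: (kernel_weight_negligible complete mOmega gamma_ge0 g0 mg
    g_gamma1 g_gamma2 c_ge0 delta0 gamma_fin mass_ge).
  exact: bounded_lebesgue_rV_lty (open_measurable_rV Omega_open).
- split; first split; first split.
  + split; first exact: measurable_cst.
    rewrite /V_norm_sq !integral0_eq ?adde0// => x _; last by rewrite expr0n.
    by rewrite integral0_eq// => y _; rewrite subrr expr0n mul0r.
  + exact: V_comb.
  + split.
      split; first exact: measurable_cst.
      by rewrite /= /L2_norm_sq integral0_eq// => y _; rewrite expr0n mul0e.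
    move=> a u v [meas_u u_fin] [mv v_fin]; split.
      exact: measurable_fun_comb.
    apply: (weighted_sqr_integral_comb_lty a mGamma _ w0 meas_u mv) => //.
    exact: measurable_funTS.
  + move=> v [mv v_fin]; split.
      apply: (eq_measurable_fun (v : lebesgue_type d -> R)).
        by move=> y /set_mem Gy; rewrite traceE.
      exact: measurable_funTS.
    rewrite /= L_traceE; apply: le_lt_trans (L_le v mv) _.
    by rewrite lte_mul_pinfty// lee_fin; lra.
  + move=> u v _ _; apply: filterS => y uv Gy; rewrite !traceE//.
    by apply: uv; right.
  + by move=> a u v _ _; apply: aeW => y Gy; rewrite !traceE.
  (* With this radius the squared norm of the difference of traces is below
     [M * e ^+ 2 / (M + 1) ^+ 2], which is less than [e ^+ 2] since [M < (M + 1) ^+ 2]. *)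
  + move=> u uV e e0; exists (e / (M + 1))%R; first by rewrite divr_gt0//; lra.
    move=> v vV.
    have [mvu _] : fs_carrier (V_space Omega gamma) (fun x => v x - u x)%R.
      have := V_comb (-1)%R u v uV vV.
      by congr (fs_carrier _ _); apply/funext => x; ring.
    rewrite /= sqrte_lt_sqr//; last by rewrite divr_gt0//; lra.
    rewrite sqrte_lt_sqr// L_trace_subE => vu.
    apply: le_lt_trans (L_le _ mvu) _.
    apply: (@lt_trans _ _ (M%:E * ((e / (M + 1)) ^+ 2)%:E)).
      by rewrite lte_pmul2l// lte_fin; lra.
    rewrite -EFinM lte_fin expr_div_n mulrCA.
    rewrite -[ltRHS]mulr1 ltr_pM2l ?exprn_gt0//.
    rewrite ltr_pdivrMr ?exprn_gt0//; [rewrite mul1r; nra|lra].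
Qed.
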